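(* There exist three caterpillar graphs $C_1, C_2, C_3$ on a common finite vertex set that cannot be simultaneously embedded, i.e. that have no $3$-layer geometric embedding.
   Context: Graphs are finite and simple. A caterpillar graph is a tree whose vertex set is the disjoint union of $V_p = \{p_1, \dots, p_{n'}\}$ (parent vertices) and $V_l$ (leg vertices, possibly empty), and whose edge set is the union of $E_p = \{p_1p_2, p_2p_3, \dots, p_{n'-1}p_{n'}\}$ (the spine path) and $E_l = \{\, p(l)\,l : l \in V_l \,\}$, where $p(l) \in V_p$ is the unique parent of the leg $l$. Let $G_i = (V, E_i)$, $1 \le i \le k$, be $k$ graphs on the same vertex set $V$ with possibly different edge sets. A $k$-layer geometric embedding (also called a simultaneous geometric embedding with mapping) of $G_1,\dots,G_k$ is an injective map $\phi : V \to \mathbb{R}^2$ such that, when every edge $uv$ is drawn as the straight segment $\overline{\phi(u)\phi(v)}$, for each $i$ the resulting drawing of $G_i$ is plane: two distinct edges of the same $E_i$ meet only at a common endpoint, and no edge of $E_i$ passes through the image of a vertex that is not one of its endpoints. Edges that do not both lie in a common $E_i$ may cross. *)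

(* Defs.v *)
From mathcomp Require Import all_boot all_order all_algebra.
From mathcomp Require Import reals.

Set Implicit Arguments.
Unset Strict Implicit.
Unset Printing Implicit Defensive.

Import Order.TTheory GRing.Theory Num.Theory.
Local Open Scope ring_scope.

Record sgraph (V : finType) := SGraph {
  adj :> rel V;
  adj_sym : symmetric adj;
  adj_irr : irreflexive adj }.

(* [ucycle] also holds of [::] and, along an edge xy, of [:: x; y]; a graph
   cycle has at least three vertices. *)
Definition is_tree (V : finType) (G : sgraph V) : Prop :=
  [/\ (0 < #|V|)%N,
      forall x y : V, connect G x y
    & forall c : seq V, ucycle G c -> (size c < 3)%N].

(* The list s is the spine p_1, ..., p_n'; [infix [:: x; y] s] says that y comes
   right after x in s. *)
Definition spine_adj (V : finType) (s : seq V) : rel V :=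
  fun x y => infix [:: x; y] s || infix [:: y; x] s.

(* The legs are the vertices outside s, so only the values of par there
   matter. *)
Definition leg_adj (V : finType) (s : seq V) (par : V -> V) : rel V :=
  fun x y => (x \notin s) && (y == par x) || (y \notin s) && (x == par y).

Definition is_caterpillar (V : finType) (G : sgraph V) : Prop :=
  is_tree G /\
  exists (s : seq V) (par : V -> V),
    [/\ s != [::],
        uniq s,
        forall l : V, l \notin s -> par l \in s
      & forall x y : V, G x y = spine_adj s x y || leg_adj s par x y].

Definition on_segment (R : realType) (p q z : 'rV[R]_2) : Prop :=
  exists t : R, 0 <= t <= 1 /\ z = (1 - t) *: p + t *: q.

Definition plane_drawing (R : realType) (V : finType) (G : sgraph V)
    (phi : V -> 'rV[R]_2) : Prop :=
  (forall u v x y : V, G u v -> G x y -> [set u; v] != [set x; y] ->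
     forall z : 'rV[R]_2,
       on_segment (phi u) (phi v) z -> on_segment (phi x) (phi y) z ->
       exists2 w : V, w \in [set u; v] :&: [set x; y] & z = phi w) /\
  (forall u v w : V, G u v -> w \notin [set u; v] ->
     ~ on_segment (phi u) (phi v) (phi w)).

Definition layer_embedding (R : realType) (V : finType) (k : nat)
    (G : 'I_k -> sgraph V) (phi : V -> 'rV[R]_2) : Prop :=
  injective phi /\ forall i : 'I_k, plane_drawing (G i) phi.

(* Main.v *)
(* The caterpillars are three Hamiltonian paths, due to Brass et al., whose union
   is a subdivision of K_{3,3} and such that any two edges lying on independent
   edges of K_{3,3} occur in a common path.  An embedding would therefore draw
   this subdivision without crossings between independent edges.

   This is excluded by parity.  After a shear the points have distinct
   abscissas.  For disjoint segments ab and cd, whether their projections to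
   the x-axis interleave is the sum mod 2 of the bits "v lies over the segment
   e", for v an endpoint of one segment and e the other; and it is also the sum
   of the four bits [x a < x c], [x b < x c], [x a < x d], [x b < x d].  Summing
   this identity over all pairs of independent edges, every "over" bit and
   every order bit appears an even number of times, but the constants 1 from
   [x a < x c] = 1 + [x c < x a] leave the contradiction 1 = 0. *)
Require Import Defs.
From mathcomp Require Import all_boot all_order all_algebra.
From mathcomp Require Import reals.
From mathcomp Require Import ring lra.

Set Implicit Arguments.
Unset Strict Implicit.
Unset Printing Implicit Defensive.

Import Order.TTheory GRing.Theory Num.Theory.

(** * Hamiltonian paths as caterpillars *)

Section SpineGraph.
Variable V : finType.
Implicit Types (s c : seq V) (x y z : V).

Lemma infix2_index s x y :
  uniq s -> infix [:: x; y] s -> index y s = (index x s).+1.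
Proof.
move=> Us /infixP[p [q sE]]; move: Us; rewrite sE cat_uniq /=.
case/and3P=> _; rewrite !negb_or => /and3P[xp yp _].
case/and3P=> /andP[xy _] _ _.
by rewrite !index_cat (negPf xp) (negPf yp) /= !eqxx (negPf xy) addn0 addn1.
Qed.

Lemma infix2_nth x0 s i :
  (i.+1 < size s)%N -> infix [:: nth x0 s i; nth x0 s i.+1] s.
Proof.
move=> lt_i; apply/infixP; exists (take i s), (drop i.+2 s).
by rewrite -[LHS](cat_take_drop i) (drop_nth x0 (ltnW lt_i)) (drop_nth x0 lt_i).
Qed.

Lemma spine_adj_sym s : symmetric (spine_adj s).
Proof. by move=> x y; rewrite /spine_adj orbC. Qed.

Lemma spine_adj_irr s : uniq s -> irreflexive (spine_adj s).
Proof.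
move=> Us x; apply/negP; rewrite /spine_adj orbb => /(infix2_index Us).
by apply/eqP; rewrite -[X in X != _]addn0 -addn1 eqn_add2l.
Qed.

Definition spine_graph s (Us : uniq s) : sgraph V :=
  SGraph (spine_adj_sym s) (spine_adj_irr Us).

Lemma spine_adj_index s x y : uniq s -> spine_adj s x y ->
  index y s = (index x s).+1 \/ index x s = (index y s).+1.
Proof. by move=> Us /orP[]/(infix2_index Us); [left | right]. Qed.

Lemma spine_connect s x y : (forall z, z \in s) -> connect (spine_adj s) x y.
Proof.
move=> sP; suff from_x0 z : connect (spine_adj s) (nth x s 0) z.
  rewrite (connect_trans _ (from_x0 y)) //.
  by rewrite (sym_connect_sym (@spine_adj_sym s)).
rewrite -(nth_index x (sP z)).
have: (index z s < size s)%N by rewrite index_mem.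
elim: (index z s) => [|i IHi] lt_i; first exact: connect0.
apply: connect_trans (IHi (ltnW lt_i)) (connect1 _).
by rewrite /spine_adj infix2_nth.
Qed.

(* At a vertex of a cycle that is last along the spine, both neighbours on the
   cycle would have to be its spine predecessor. *)
Lemma spine_acyclic s c : uniq s -> (forall z, z \in s) ->
  ucycle (spine_adj s) c -> (size c < 3)%N.
Proof.
move=> Us sP; rewrite ltnNge; case: c => // x0 c /andP[cyc Uc].
apply/negP => sz3.
have x0c : x0 \in x0 :: c by rewrite mem_head.
case: (@arg_maxnP _ x0 (mem (x0 :: c)) (index^~ s) x0c) => x xc xmax.
have [i d dE] := rot_to xc.
have: uniq (x :: d) by rewrite -dE rot_uniq.
have: cycle (spine_adj s) (x :: d) by rewrite -dE rot_cycle.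
have : (2 < size (x :: d))%N by rewrite -dE size_rot.
have pred_x y : y \in x :: d -> spine_adj s x y -> index x s = (index y s).+1.
  rewrite -dE mem_rot => /xmax yle /(spine_adj_index Us)[] // yx.
  by move: (yle : (index y s <= index x s)%N); rewrite yx ltnn.
case: d dE pred_x => [|y d] // _; case/lastP: d => // d z pred_x _ /=.
rewrite rcons_path last_rcons => /andP[xy /andP[_ zx]].
case/and3P=> _; rewrite mem_rcons inE negb_or => /andP[/eqP + _] _.
apply; apply: (index_inj x (sP y) (sP z)).
apply: succn_inj; rewrite -!pred_x //; last by rewrite !inE eqxx orbT.
  by rewrite !inE mem_rcons mem_head !orbT.
by rewrite spine_adj_sym.
Qed.

Lemma spine_caterpillar s (Us : uniq s) :
  s != [::] -> (forall z, z \in s) -> is_caterpillar (spine_graph Us).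
Proof.
move=> sN0 sP; split.
  split=> [|a b|c].
  - by case: s sN0 {Us sP} => // x s _; apply/card_gt0P; exists x.
  - exact: spine_connect.
  - exact: spine_acyclic.
(* All vertices lie on the spine, so there are no legs; [id] is a placeholder. *)
exists s, id; split=> // x y.
by rewrite /leg_adj !sP orbF.
Qed.

End SpineGraph.

Local Open Scope ring_scope.

(** * The parity law for two disjoint segments *)

Section Crossings.
Variables (R : realFieldType) (T : Type) (x y : T -> R).
Implicit Types (a b c d v : T).

Lemma affine_root (m k s t : R) : s <= t ->
  ((0 < m * s + k) != (0 < m * t + k)) ->
  exists2 r, s <= r <= t & m * r + k = 0.
Proof.
move=> st sgn.
have [m0|mN0] := eqVneq m 0; first by move: sgn; rewrite m0 !mul0r eqxx.
exists (- k / m); last by rewrite mulrC divfK // addNr.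
have kE : k = - ((- k / m) * m) by rewrite divfK // opprK.
move: (- k / m) kE sgn => r ->.
have [mgt|mlt|m0] := ltgtP m 0; last by rewrite m0 eqxx in mN0.
all: by case: ltP => h1; case: ltP => h2 //= _; apply/andP; split; nra.
Qed.

Definition height a b (s : R) := y a + (y b - y a) / (x b - x a) * (s - x a).

Lemma height_left a b : height a b (x a) = y a.
Proof. by rewrite /height subrr mulr0 addr0. Qed.

Lemma height_sym a b s : x a != x b -> height a b s = height b a s.
Proof.
move=> ab; rewrite /height; field.
by rewrite !subr_eq0 ab eq_sym ab.
Qed.

Lemma height_right a b : x a != x b -> height a b (x b) = y b.
Proof. by move=> ab; rewrite height_sym // height_left. Qed.

Definition between a b v := (x a < x v) (+) (x b < x v).
Definition over a b v := between a b v && (height a b (x v) < y v).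

Lemma over_sym a b v : x a != x b -> over a b v = over b a v.
Proof. by move=> ab; rewrite /over /between addbC height_sym. Qed.

(** For non-vertical segments ab and cd, this is disjointness. *)
Definition heights_differ a b c d := forall s : R,
  Num.min (x a) (x b) <= s <= Num.max (x a) (x b) ->
  Num.min (x c) (x d) <= s <= Num.max (x c) (x d) ->
  height a b s != height c d s.

(** The difference of the heights is affine, so a change of sign would force a common point. *)
Lemma height_lt_const a b c d s t : x a < x b -> x c < x d ->
  heights_differ a b c d ->
  x a <= s -> x c <= s -> s <= t -> t <= x b -> t <= x d ->
  (height a b s < height c d s) = (height a b t < height c d t).
Proof.
move=> ab cd dif as_ cs st tb td; apply/eqP; apply: contraT.
set m := (y d - y c) / (x d - x c) - (y b - y a) / (x b - x a).
set k := (y c - (y d - y c) / (x d - x c) * x c) -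
         (y a - (y b - y a) / (x b - x a) * x a).
have hE r : height c d r - height a b r = m * r + k.
  by rewrite /height /m /k; ring.
rewrite -2![_ < height c d _]subr_gt0 !hE => /(affine_root st)[r /andP[sr rt] r0].
have /eqP := r0; rewrite -hE subr_eq0 eq_sym => r0'.
suff: height a b r != height c d r by rewrite r0'.
apply: dif.
- by rewrite (min_l (ltW ab)) (max_r (ltW ab)) (le_trans as_) //= (le_trans rt).
- by rewrite (min_l (ltW cd)) (max_r (ltW cd)) (le_trans cs) //= (le_trans rt).
Qed.

(* The left-hand side is the bit "the projections of ab and cd interleave". *)
Definition parity_law a b c d :=
  between a b c (+) between a b d =
  over a b c (+) over a b d (+) (over c d a (+) over c d b).

(** If the projections are disjoint, all over bits vanish. Otherwise the same segment is lower at
    both ends of the common interval: the bits of c over ab and b over cd then differ when the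
    projections interleave, and those of c and d over ab agree when they are nested. *)
Lemma parity_law_oriented a b c d :
  x a < x b -> x c < x d -> x a < x c -> x b != x c -> x b != x d ->
  heights_differ a b c d -> parity_law a b c d.
Proof.
move=> ab cd ac bc bd dif; rewrite /parity_law /over /between.
have ad := lt_trans ac cd.
rewrite ac ad (lt_gtF ac) (lt_gtF ad) /=.
have [bc'|cb|E] := ltgtP (x b) (x c); last by rewrite E eqxx in bc.
  by rewrite (lt_trans bc' cd) /= (lt_gtF (lt_trans bc' cd)).
have [bd'|db|E] := ltgtP (x b) (x d); last by rewrite E eqxx in bd.
  have := height_lt_const ab cd dif (ltW ac) (lexx _) (ltW cb) (lexx _) (ltW bd').
  rewrite height_left (height_right (negbT (lt_eqF ab))) /= => ->.
  rewrite addbF.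
  have : height a b (x b) != height c d (x b).
    apply: dif; first by rewrite (min_l (ltW ab)) (max_r (ltW ab)) lexx ltW.
    by rewrite (min_l (ltW cd)) (max_r (ltW cd)) !ltW.
  rewrite (height_right (negbT (lt_eqF ab))).
  by case: ltgtP.
have := height_lt_const ab cd dif (ltW ac) (lexx _) (ltW cd) (ltW db) (lexx _).
rewrite height_left (height_right (negbT (lt_eqF cd))) /= => ->.
by rewrite addbb.
Qed.

Lemma parity_lawP a b c d :
  x a != x b -> x c != x d -> x a != x c -> x a != x d ->
  x b != x c -> x b != x d ->
  heights_differ a b c d -> parity_law a b c d.
Proof.
wlog ab : a b / x a < x b => [W|].
  move=> ab cd ac ad bc bd dif.
  case: (ltgtP (x a) (x b)) => [h|h|E]; last by rewrite E eqxx in ab.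
    exact: W.
  have ba : x b != x a by rewrite eq_sym.
  have: parity_law b a c d.
    apply: W => // s; rewrite minC maxC => h1 h2.
    by rewrite height_sym //; apply: dif.
  rewrite /parity_law /between !(over_sym _ ba) => E.
  rewrite [over c d a (+) _]addbC -E.
  by rewrite ![(x b < _) (+) _]addbC.
wlog cd : c d / x c < x d => [W|].
  move=> _ cd ac ad bc bd dif.
  case: (ltgtP (x c) (x d)) => [h|h|E]; last by rewrite E eqxx in cd.
    by apply: W => //; rewrite lt_eqF.
  have dc : x d != x c by rewrite eq_sym.
  have: parity_law a b d c.
    apply: W => //; first by rewrite lt_eqF.
    move=> s h1; rewrite minC maxC => h2.
    by rewrite (height_sym _ dc) //; apply: dif.
  rewrite /parity_law !(over_sym _ dc) => E.
  by rewrite addbC E [over a b d (+) _]addbC.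
move=> _ _ ac ad bc bd dif.
case: (ltgtP (x a) (x c)) => [h|h|E]; last by rewrite E eqxx in ac.
  exact: parity_law_oriented.
have: parity_law c d a b.
  apply: parity_law_oriented => //; try by rewrite eq_sym.
  by move=> s h1 h2; rewrite eq_sym; apply: dif.
rewrite /parity_law [RHS]addbC => <-.
(* Exchanging the segments negates all four order bits, which preserves their sum. *)
have lt_flip u v : x u != x v -> (x u < x v) = ~~ (x v < x u).
  by case: ltgtP.
rewrite /between !(lt_flip c, lt_flip d) 1?eq_sym //.
by do 4!case: (_ < _).
Qed.

End Crossings.

(** * A shear giving distinct abscissas *)

Section Shear.
Variables (R : realFieldType) (V : finType) (phi : V -> 'rV[R]_2).

Lemma exists_notin (s : seq R) : exists l : R, l \notin s.
Proof.
suff [l /allP lP] : exists l : R, all (< l) s.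
  by exists l; apply/negP => /lP; rewrite /= ltxx.
elim: s => [|r s [l /allP lP]]; first by exists 0.
exists (Num.max l (r + 1)); rewrite /= lt_max ltrDl ltr01 orbT /=.
by apply/allP => q /lP /= ql; rewrite lt_max ql.
Qed.

Definition shear (l : R) (p : 'rV[R]_2) : R := p 0 0 + l * p 0 1.

Lemma rV2_eq (p q : 'rV[R]_2) : p 0 0 = q 0 0 -> p 0 1 = q 0 1 -> p = q.
Proof.
move=> e0 e1; apply/rowP => i; case: i => [[|[|//]] hi].
  by rewrite (_ : Ordinal hi = 0) //; apply: val_inj.
by rewrite (_ : Ordinal hi = 1) //; apply: val_inj.
Qed.

Lemma injective_shear : injective phi ->
  exists l : R, injective (fun v => shear l (phi v)).
Proof.
move=> inj.
(* These are the finitely many bad values of [l]; pairs of equal ordinate only add 0, the value of a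
   division by 0. *)
have [l lP] := exists_notin
  [seq (phi v 0 0 - phi u 0 0) / (phi u 0 1 - phi v 0 1)
     | u <- enum V, v <- enum V].
exists l => u v; rewrite /shear => E; apply: inj.
have [e1|n1] := eqVneq (phi u 0 1) (phi v 0 1).
  by apply: rV2_eq => //; move: E; rewrite e1 => /addIr.
case/negP: lP; apply/allpairsP; exists (u, v); rewrite !mem_enum; split=> //=.
apply: (canRL (mulfK _)); first by rewrite subr_eq0.
by rewrite mulrBr; lra.
Qed.

End Shear.

(** * From plane drawings to parity laws *)

Section PlaneDrawing.
Variables (R : realType) (V : finType) (phi : V -> 'rV[R]_2) (l : R).
Let x v := shear l (phi v).
Let y v := phi v 0 1.
Hypothesis x_inj : injective x.

(** The shear is linear and keeps ordinates, so the parameter of the sheared point on its segment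
    also serves for [z]. *)
Lemma on_segment_height a b (s : R) (z : 'rV[R]_2) : a != b ->
  Num.min (x a) (x b) <= s <= Num.max (x a) (x b) ->
  shear l z = s -> z 0 1 = height x y a b s -> on_segment (phi a) (phi b) z.
Proof.
move=> ab sab zs zh.
have xab : x b - x a != 0 by rewrite subr_eq0 (inj_eq x_inj) eq_sym.
exists ((s - x a) / (x b - x a)); split.
  move: sab xab; case: (ltgtP (x a) (x b)) => [h|h|->]; last by rewrite subrr eqxx.
    move=> /andP[h1 h2] _; rewrite divr_ge0 ?subr_ge0 ?(ltW h) //=.
    by rewrite ler_pdivrMr ?subr_gt0 // mul1r lerD2r.
  move=> /andP[h1 h2] _; rewrite -mulrNN -invrN !opprB.
  rewrite divr_ge0 ?subr_ge0 ?(ltW h) //=.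
  by rewrite ler_pdivrMr ?subr_gt0 // mul1r lerD2l lerN2.
have z1 : z 0 1 = (1 - (s - x a) / (x b - x a)) * y a
                  + (s - x a) / (x b - x a) * y b.
  by rewrite zh /height; field.
apply: rV2_eq; rewrite !mxE //.
move: zs => /(canRL (addrK _)) ->; rewrite z1.
have p0 v : phi v 0 0 = x v - l * y v by rewrite /x /shear addrK.
rewrite !p0 -/(y a) -/(y b); field.
exact: xab.
Qed.

Lemma plane_parity_law (G : sgraph V) a b c d :
  plane_drawing G phi -> G a b -> G c d -> uniq [:: a; b; c; d] ->
  parity_law x y a b c d.
Proof.
move=> [plane _] Gab Gcd /=; rewrite !inE !negb_or.
case/and4P=> /and3P[ab ac ad] /andP[bc bd] cd _.
have xN u v : u != v -> x u != x v by rewrite (inj_eq x_inj).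
apply: parity_lawP; try exact: xN.
move=> s sab scd; apply/eqP => E.
(* The preimage under the shear of the common point at abscissa [s]. *)
pose z : 'rV[R]_2 :=
  \row_j (if j == 0 then s - l * height x y a b s else height x y a b s).
have zs : shear l z = s by rewrite /shear !mxE /= subrK.
have z1 : z 0 1 = height x y a b s by rewrite mxE.
have ne : [set a; b] != [set c; d].
  apply/eqP => /setP/(_ a); rewrite !inE eqxx /=.
  by rewrite (negPf ac) (negPf ad).
have [w] := plane a b c d Gab Gcd ne z (on_segment_height ab sab zs z1)
   (on_segment_height cd scd zs (etrans z1 E)).
rewrite !inE => /andP[/orP[]/eqP->]; first by rewrite (negPf ac) (negPf ad).
by rewrite (negPf bc) (negPf bd).
Qed.

End PlaneDrawing.

(** * Summing the parity laws over K_{3,3} *)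

Lemma addb_even_count (K : eqType) (F : K -> bool) (s : seq K) :
  all (fun k => ~~ odd (count_mem k s)) s ->
  \big[addb/false]_(k <- s) F k = false.
Proof.
move=> /allP even_s; rewrite -big_undup_iterop_count big_seq big1 // => k.
rewrite mem_undup => /even_s; set n := count_mem k s => odd_n.
rewrite -[n]odd_double_half (negPf odd_n) add0n.
by elim: n./2 => // m IHm; move: IHm; rewrite doubleS !Monoid.iteropE /= => ->; case: (F k).
Qed.

Section ParityTerms.
Variables (n : nat) (R : realFieldType) (x y : 'I_n -> R).
Implicit Types a b c d : 'I_n.

(* Codes for the bits occurring in parity laws: [::] is the constant 1,
   [:: a; c] the bit x a < x c, and [:: a; b; v] the bit over a b v. *)
Definition bit (k : seq 'I_n) : bool :=
  match k with
  | [::] => true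
  | [:: a; c] => x a < x c
  | [:: a; b; v] => over x y a b v
  | _ => false
  end.

(** Order bits are normalised to increasing indices, so that both orientations of a pair can
    cancel. *)
Definition lt_bits a c : seq (seq 'I_n) :=
  if (a < c)%N then [:: [:: a; c]] else [:: [::]; [:: c; a]].

Definition law_bits a b c d : seq (seq 'I_n) :=
  lt_bits a c ++ lt_bits b c ++ lt_bits a d ++ lt_bits b d ++
  [:: [:: a; b; c]; [:: a; b; d]; [:: c; d; a]; [:: c; d; b]].

Lemma sum_lt_bits a c : x a != x c ->
  \big[addb/false]_(k <- lt_bits a c) bit k = (x a < x c).
Proof.
rewrite /lt_bits; case: ifP => _ ac; rewrite !big_cons big_nil /= !addbF //.
by move: ac; case: ltgtP.
Qed.

Lemma sum_law_bits a b c d : injective x -> uniq [:: a; b; c; d] ->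
  parity_law x y a b c d ->
  \big[addb/false]_(k <- law_bits a b c d) bit k = false.
Proof.
move=> x_inj /=; rewrite !inE !negb_or.
case/and4P=> /and3P[_ ac ad] /andP[bc bd] _ _; rewrite /parity_law /between => E.
rewrite !big_cat !big_cons big_nil !sum_lt_bits ?(inj_eq x_inj) //=.
by move: E; do 4!case: (_ < _); do 4!case: over.
Qed.

End ParityTerms.

(* The three paths of Brass et al. on the vertices 1, ..., 9 (9 is 0 in 'I_9).
   Their union is a subdivision of K_{3,3} with parts {1, 2, 3} and {4, 5, 6}. *)
Definition spines : 3.-tuple (seq 'I_9) :=
  [tuple map inZp [:: 7; 1; 4; 2; 6; 9; 3; 5; 8]%N;
         map inZp [:: 8; 2; 4; 3; 5; 7; 1; 6; 9]%N;
         map inZp [:: 7; 5; 8; 2; 6; 1; 4; 3; 9]%N].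

(* Each edge of the subdivision is preceded by the edge of K_{3,3} it lies on. *)
Definition K33_edges : seq ((nat * nat) * ('I_9 * 'I_9)) :=
  [seq (e.1, (inZp e.2.1, inZp e.2.2)) | e <-
    [:: ((1, 4), (1, 4)); ((1, 5), (1, 7)); ((1, 5), (7, 5)); ((1, 6), (1, 6));
        ((2, 4), (2, 4)); ((2, 5), (2, 8)); ((2, 5), (8, 5)); ((2, 6), (2, 6));
        ((3, 4), (3, 4)); ((3, 5), (3, 5)); ((3, 6), (3, 9)); ((3, 6), (9, 6))]%N].

(** The strict inequality between the ends in {1, 2, 3} makes each unordered pair occur once. *)
Definition K33_far_pairs : seq (('I_9 * 'I_9) * ('I_9 * 'I_9)) :=
  [seq (p.1.2, p.2.2) | p <- [seq (e, f) | e <- K33_edges, f <- K33_edges]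
   & (p.1.1.1 < p.2.1.1)%N && (p.1.1.2 != p.2.1.2)].

Definition K33_bits : seq (seq 'I_9) :=
  flatten [seq law_bits p.1.1 p.1.2 p.2.1 p.2.2 | p <- K33_far_pairs].

Lemma K33_far_pairs_share_spine :
  all (fun p => uniq [:: p.1.1; p.1.2; p.2.1; p.2.2] &&
    has (fun s => spine_adj s p.1.1 p.1.2 && spine_adj s p.2.1 p.2.2) spines)
    K33_far_pairs.
Proof. by vm_compute. Qed.

(** The laws contain the constant 1 an odd number of times; the extra [[::]] makes its count
    even. *)
Lemma K33_bits_even :
  all (fun k => ~~ odd (count_mem k ([::] :: K33_bits))) ([::] :: K33_bits).
Proof. by vm_compute. Qed.

Lemma spine_uniq i : uniq (tnth spines i).
Proof. by move: i; apply/all_tnthP. Qed.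

Lemma spine_full i z : z \in tnth spines i.
Proof.
have /all_tnthP/(_ i) szI : all (fun s => size s == 9)%N spines by [].
have [||_ ->] := @uniq_min_size _ _ (enum 'I_9) (spine_uniq i); rewrite ?mem_enum //.
  by move=> a _; rewrite mem_enum.
by rewrite size_enum_ord (eqP szI).
Qed.

Theorem theorem5 (R : realType) :
  exists (V : finType) (C : 'I_3 -> sgraph V),
    (forall i : 'I_3, is_caterpillar (C i)) /\
    ~ exists phi : V -> 'rV[R]_2, layer_embedding C phi.
Proof.
exists 'I_9, (fun i => spine_graph (spine_uniq i)); split=> [i|[phi [inj plane]]].
  apply: spine_caterpillar; last exact: spine_full.
  by apply: contraTneq (spine_full i ord0) => ->.
have [l x_inj] := injective_shear inj.
pose x v := shear l (phi v); pose y v := phi v 0 1.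
have := addb_even_count (bit x y) K33_bits_even.
(* Once every law sums to 0, only the extra constant 1 is left, in a sum equal to 0. *)
rewrite big_cons /= big_flatten big_map big_seq big1 // => -[[a b] [c d]].
move=> /(allP K33_far_pairs_share_spine)/andP[abcd].
case/hasP=> _ /tnthP[i ->] /andP[ab cd].
apply: (sum_law_bits x_inj abcd).
exact: (plane_parity_law x_inj (plane i) ab cd abcd).
Qed.
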